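(* For all $x\in[0,\pi_{3/2,6}/4)$, $$\sin_{3/2,6}(2x)=\frac{2\sin_{3/2,6}x}{\left(1+18\sin_{3/2,6}^6x-27\sin_{3/2,6}^{12}x\right)^{1/3}}.$$
   Context: For $p,q>1$, let $\pi_{p,q}=2\int_0^1\frac{dt}{(1-t^q)^{1/p}}<\infty$, and let $\sin_{p,q}:[0,\pi_{p,q}/2)\to[0,1)$ be the inverse function of $y\mapsto\int_0^y \frac{dt}{(1-t^q)^{1/p}}$, $y\in[0,1)$. The notation $\sin_{p,q}^a x$ means $(\sin_{p,q}x)^a$. *)

(* Defs.v *)
From mathcomp Require Import all_boot all_order all_algebra.
From mathcomp Require Import all_classical all_reals all_analysis.

Set Implicit Arguments.
Unset Strict Implicit.
Unset Printing Implicit Defensive.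

Import Order.TTheory GRing.Theory Num.Theory.
Import numFieldNormedType.Exports.

Local Open Scope classical_set_scope.
Local Open Scope ring_scope.

(* At t = 1 the denominator is 0 and, by the convention 0^-1 = 0, so is the
   value; this affects no integral below since {1} is Lebesgue-null. *)
Definition gsin_integrand (R : realType) (p q t : R) : R :=
  1 / ((1 - t `^ q) `^ (1 / p)).

Definition garcsin (R : realType) (p q y : R) : R :=
  \int[lebesgue_measure]_(t in `[0, y]) gsin_integrand p q t.

(* The Lebesgue integral of the nonnegative integrand over [0, 1] is the
   improper integral; it is finite when p, q > 1. *)
Definition gpi (R : realType) (p q : R) : R :=
  2 * \int[lebesgue_measure]_(t in `[0, 1]) gsin_integrand p q t.

(* The inverse of [garcsin p q] on [0, 1[, meaningful on [0, gpi p q / 2[;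
   outside the image of [0, 1[ the value is a dummy 0. *)
Definition gsin (R : realType) (p q : R) : R -> R :=
  'pinv_(fun=> 0) `[0, 1[ (garcsin p q).

(* Main.v *)
(* Write A = garcsin (3/2) 6 and let g be the rational-radical map of the
   duplication formula, g(s) = 2 s D^(-1/3) with D = 1 + 18 u - 27 u^2 and
   u = s^6. The factorization D^2 - 64 u = (1 - u) (1 - 9 u)^3 gives
   1 - g^6 = (1 - u) (1 - 9 u)^3 / D^2, while g' = 2 (1 - 9 u)^2 D^(-4/3), so
   that (1 - g^6)^(-2/3) g' = 2 (1 - u)^(-2/3), i.e. (A o g)' = 2 A'. Hence
   A (g s) = 2 A s for 9 u <= 1. At 9 u = 1 one has g = 1, so the corresponding
   s is the generalized sine of pi_{3/2,6} / 4 and every x below that value is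
   A s for some s with 9 u < 1. *)
Require Import Defs.
From mathcomp Require Import all_boot all_order all_algebra.
From mathcomp Require Import all_classical all_reals all_analysis.
From mathcomp Require Import measurable_realfun ring lra.

Import Order.TTheory GRing.Theory Num.Theory.
Import numFieldNormedType.Exports.

Local Open Scope ring_scope.

(** * The integrand of the generalized arcsine *)

Lemma gsin_integrandE (R : realType) (p q t : R) :
  gsin_integrand p q t = (1 - t `^ q) `^ (- (1 / p)).
Proof. by rewrite /gsin_integrand powRN mul1r. Qed.

Lemma measurable_gsin_integrand (R : realType) (p q : R) :
  measurable_fun setT (gsin_integrand p q).
Proof.
have -> : gsin_integrand p q =
    (@powR R ^~ (- (1 / p))) \o ((fun t => 1 - t) \o (@powR R ^~ q)).
  by apply/funext => t; rewrite /= gsin_integrandE.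
apply: measurableT_comp; first exact: measurable_powR.
apply: measurableT_comp; last exact: measurable_powR.
exact: measurable_funB.
Qed.

(* A divergent integral has [fine +oo = 0], hence positivity gives
   convergence. *)
Lemma integrable_gsin_integrand (R : realType) (p q : R) :
  0 < gpi p q ->
  lebesgue_measure.-integrable `[0, 1]%classic (EFin \o gsin_integrand p q).
Proof.
move=> gpi0; apply/integrableP; split.
  apply/measurable_EFinP.
  exact: measurable_funS (measurable_gsin_integrand R p q).
under eq_integral => t _.
  rewrite /= ger0_norm; last by rewrite gsin_integrandE powR_ge0.
  over.
rewrite ltey; apply: contraPneq gpi0 => oo.
by rewrite /gpi /Rintegral oo /= mulr0 ltxx.
Qed.

Lemma powR_itv01 (R : realType) (q t : R) :
  0 < q -> 0 < t < 1 -> 0 < t `^ q < 1.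
Proof.
move=> q0 /andP[t0 t1]; rewrite powR_gt0//=.
have := gt0_ltr_powR q0 _ _ t1; rewrite powR1; apply.
- by rewrite nnegrE ltW.
- by rewrite nnegrE ler01.
Qed.

Lemma gsin_integrand_gt0 (R : realType) (p q t : R) :
  0 < q -> 0 < t < 1 -> 0 < gsin_integrand p q t.
Proof.
move=> q0 t01; rewrite gsin_integrandE powR_gt0// subr_gt0.
by have /andP[] := powR_itv01 R q t q0 t01.
Qed.

Lemma continuous_gsin_integrand (R : realType) (p q t : R) :
  0 < q -> 0 < t < 1 -> {for t, continuous (gsin_integrand p q)}.
Proof.
move=> q0 t01; have /andP[t0 _] := t01.
have /andP[_ tq1] := powR_itv01 R q t q0 t01.
have -> : gsin_integrand p q =
    (@powR R ^~ (- (1 / p))) \o (cst 1 - (@powR R ^~ q)).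
  by apply/funext => u; rewrite gsin_integrandE.
apply/differentiable_continuous/derivable1_diffP.
have D1 := is_derive1_powR q t0.
have D2 := is_derive1_powR (- (1 / p)) (etrans (subr_gt0 _ _) tq1).
have D3 : is_derive t 1 (cst 1 - (@powR R ^~ q)) (0 - q * t `^ (q - 1)).
  exact: is_deriveB.
by case: (@is_derive1_comp _ (@powR R ^~ (- (1 / p))) (cst 1 - (@powR R ^~ q))
  _ _ _ D2 D3).
Qed.

(** * The generalized arcsine and its inverse *)

Lemma is_derive_garcsin (R : realType) (p q y : R) :
  0 < q -> 0 < gpi p q -> 0 < y < 1 ->
  is_derive y 1 (garcsin p q) (gsin_integrand p q y).
Proof.
move=> q0 gpi0 y01; have /andP[y0 y1] := y01.
have [dA A'] := continuous_FTC1_closed y1 (integrable_gsin_integrand R p q gpi0)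
  y0 (continuous_gsin_integrand R p q y q0 y01).
by apply: DeriveDef => //; rewrite -derive1E.
Qed.

Lemma continuous_garcsin (R : realType) (p q : R) :
  0 < gpi p q -> {within `[0, 1], continuous (@garcsin R p q)}%classic.
Proof.
move=> gpi0; apply: parameterized_integral_continuous => //.
exact: integrable_gsin_integrand.
Qed.

Lemma garcsin0 (R : realType) (p q : R) : garcsin p q 0 = 0.
Proof. by rewrite /garcsin set_itv1 Rintegral_set1. Qed.

Lemma garcsin1 (R : realType) (p q : R) : 2 * garcsin p q 1 = gpi p q.
Proof. by []. Qed.

(** A positive derivative on the open interval and continuity on the closed one suffice, so the
    endpoint 1, where the integrand is singular, is covered. *)
Lemma garcsin_lt (R : realType) (p q : R) : 0 < q -> 0 < gpi p q ->
  {in `[0, 1] &, {mono @garcsin R p q : x y / x < y}}.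
Proof.
move=> q0 gpi0; apply: leW_mono_in; apply: le_mono_in.
apply: gtr0_derive1_lt_cc; last exact: continuous_garcsin.
- by move=> x x01; case: (is_derive_garcsin R p q x q0 gpi0 x01).
- move=> x x01; rewrite derive1E.
  have D := is_derive_garcsin R p q x q0 gpi0 x01.
  by rewrite derive_val; exact: gsin_integrand_gt0.
Qed.

Lemma garcsinK (R : realType) (p q : R) : 0 < q -> 0 < gpi p q ->
  {in `[0, 1[, cancel (@garcsin R p q) (gsin p q)}.
Proof.
move=> q0 gpi0 y y01; apply: pinvKV; last by rewrite inE.
move=> u v; rewrite !inE/= !in_itv/= => /andP[u0 u1] /andP[v0 v1] uv.
have M := garcsin_lt R p q q0 gpi0.
by case: (ltgtP u v) => // /[dup] + _; rewrite -M ?in_itv/= ?uv ?ltxx//;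
  apply/andP; split=> //; exact: ltW.
Qed.

Lemma gsin_inv (R : realType) (p q x : R) : 0 < q -> 0 < gpi p q ->
  0 <= x < gpi p q / 2 -> 0 <= gsin p q x < 1 /\ garcsin p q (gsin p q x) = x.
Proof.
move=> q0 gpi0 /andP[x0 x1].
have [|||y y01 yx] := @IVT R (garcsin p q) 0 1 x; first exact: ler01.
- exact: continuous_garcsin.
- have := garcsin1 R p q; rewrite garcsin0 => E.
  have A1 : x <= garcsin p q 1 by lra.
  by rewrite ge_min x0/= le_max A1 orbT.
(* The intermediate value theorem allows [y = 1], but that would force [x = gpi p q / 2]. *)
have y1 : 0 <= y < 1.
  move: y01; rewrite in_itv/= => /andP[-> ]; rewrite le_eqVlt => /predU1P[y1|//].
  by move: x1; rewrite -yx y1 -garcsin1 mulrC mulKf// ltxx.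
by rewrite -yx garcsinK.
Qed.

(** Meant for [garcsin] after [sin_dup]: the outer map is known to be continuous only relative to
    [0, 1], and the inner one reaches the boundary point 1. *)
Lemma within_continuous_comp_within (U V W : topologicalType) (A : set U) (B : set V)
    (f : U -> V) (g : V -> W) :
  (f @` A `<=` B)%classic -> {within B, continuous g}%classic ->
  {within A, continuous f}%classic -> {within A, continuous (g \o f)}%classic.
Proof.
move=> fAB /subspace_continuousP cg /subspace_continuousP cf.
apply/subspace_continuousP => x Ax.
apply: (@cvg_comp _ _ _ f g _ (within B (nbhs (f x)))); last first.
  by apply: cg; apply: fAB; exists x.
move=> E /= nE; have := cf x Ax _ nE; rewrite /= !nbhs_simpl/=.
rewrite /within/=; apply: filterS => z zE Az.
by apply: zE => //; apply: fAB; exists z.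
Qed.

(** * The duplication map: [D] and [g] of the overview, and their algebra *)

Definition sin_dup_denom (R : realType) (s : R) : R :=
  1 + 18 * s ^+ 6 - 27 * s ^+ 12.

Definition sin_dup (R : realType) (s : R) : R :=
  2 * s * sin_dup_denom R s `^ (- (1 / 3)).

Lemma powRX (R : realType) (a r : R) (n : nat) :
  0 <= a -> (a ^+ n) `^ r = a `^ (n%:R * r).
Proof. by move=> a0; rewrite -powR_mulrn// powRrM. Qed.

Lemma cube_powRN13 (R : realType) (a : R) :
  0 < a -> (a `^ (- (1 / 3))) ^+ 3 = a^-1.
Proof.
move=> a0; rewrite -powR_mulrn ?powR_ge0// -powRrM.
by rewrite (_ : _ * _ = -1) ?powR_inv1 ?ltW//; field.
Qed.

Lemma is_derive_sin_dup_denom (R : realType) (s : R) :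
  is_derive s 1 (@sin_dup_denom R) (108 * s ^+ 5 - 324 * s ^+ 11).
Proof.
have -> : @sin_dup_denom R = cst 1 + 18 \*: (id ^+ 6) - 27 \*: (id ^+ 12).
  by apply/funext => u; rewrite /sin_dup_denom !fctE.
apply: is_derive_eq; rewrite /GRing.scale/=; ring.
Qed.

(** The square comes from D - s D' / 3 = 1 - 18 u + 81 u^2 with u = s^6. *)
Lemma is_derive_sin_dup (R : realType) (s : R) : 0 < sin_dup_denom R s ->
  is_derive s 1 (@sin_dup R) (2 * (1 - 9 * s ^+ 6) ^+ 2 *
    sin_dup_denom R s `^ (- (1 / 3)) / sin_dup_denom R s).
Proof.
move=> D0.
have D1 := is_derive1_powR (- (1 / 3)) D0.
have D2 := @is_derive1_comp _ (@powR R ^~ (- (1 / 3))) _ _ _ _ D1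
  (is_derive_sin_dup_denom R s).
have -> : @sin_dup R =
    (2 \*: id) * ((@powR R ^~ (- (1 / 3))) \o @sin_dup_denom R).
  by apply/funext => u; rewrite /sin_dup !fctE.
apply: is_derive_eq; rewrite -![_ *: _]/(_ * _) /= powRB; last first.
  by apply/implyP => _; rewrite gt_eqF.
rewrite powRr1 ?ltW//.
set c := _ `^ _; rewrite /sin_dup_denom in D0 *; rewrite -[2 *: s]/(2 * s); field.
by rewrite gt_eqF.
Qed.

(** The factor D^(-2) is kept as the sixth power of D^(-1/3), so that its power -2/3 is again an
    integer power of D^(-1/3). *)
Lemma one_sub_sin_dup6 (R : realType) (s : R) : 0 < sin_dup_denom R s ->
  1 - sin_dup R s ^+ 6 = (1 - s ^+ 6) * (1 - 9 * s ^+ 6) ^+ 3 *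
    (sin_dup_denom R s `^ (- (1 / 3))) ^+ 6.
Proof.
move=> D0; rewrite /sin_dup exprMn -[6%N]/(3 * 2)%N (exprM (_ `^ _)).
rewrite cube_powRN13//; rewrite /sin_dup_denom in D0 *; field.
by rewrite gt_eqF.
Qed.

(** D = 1 + 9 u (2 - 3 u) with 0 <= u <= 1/9. *)
Lemma sin_dup_denom_gt0 (R : realType) (s : R) :
  9 * s ^+ 6 <= 1 -> 0 < sin_dup_denom R s.
Proof.
move=> s9; rewrite /sin_dup_denom -[12%N]/(6 * 2)%N exprM.
have : 0 <= s ^+ 6 by rewrite (@exprM _ _ 2 3) exprn_ge0 ?sqr_ge0.
nra.
Qed.

Lemma sin_dup_ge0 (R : realType) (s : R) : 0 <= s -> 0 <= sin_dup R s.
Proof. by move=> s0; rewrite /sin_dup !mulr_ge0 ?powR_ge0. Qed.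

Lemma sin_dup_lt1 (R : realType) (s : R) :
  0 <= s -> 9 * s ^+ 6 < 1 -> sin_dup R s < 1.
Proof.
move=> s0 s9; have D0 := sin_dup_denom_gt0 R s (ltW s9).
rewrite -(@expr_lt1 _ 6) ?sin_dup_ge0// -subr_gt0 one_sub_sin_dup6//.
rewrite !mulr_gt0 ?exprn_gt0 ?powR_gt0//; lra || (have := exprn_ge0 6 s0; lra).
Qed.

Lemma sin_dup_eq1 (R : realType) (s : R) :
  0 <= s -> 9 * s ^+ 6 = 1 -> sin_dup R s = 1.
Proof.
move=> s0 s9; apply/eqP; rewrite -(@pexpr_eq1 _ _ 6) ?sin_dup_ge0//.
rewrite eq_sym -subr_eq0 one_sub_sin_dup6; last by rewrite sin_dup_denom_gt0 ?s9.
by rewrite s9 subrr expr0n/= mulr0 mul0r.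
Qed.

(** With v = 1 - 9 u and c = D^(-1/3), the integrand contributes (1 - u)^(-2/3) v^(-2) c^(-4) and
    the derivative of [sin_dup] is 2 v^2 c^4, so v and c cancel. *)
Lemma gsin_integrand_sin_dup (R : realType) (s : R) : 0 < s -> 9 * s ^+ 6 < 1 ->
  gsin_integrand (3 / 2) 6 (sin_dup R s) * (2 * (1 - 9 * s ^+ 6) ^+ 2 *
    sin_dup_denom R s `^ (- (1 / 3)) / sin_dup_denom R s) =
  2 * gsin_integrand (3 / 2) 6 s.
Proof.
move=> s0 s9; have D0 := sin_dup_denom_gt0 R s (ltW s9).
rewrite !gsin_integrandE !powR_mulrn ?sin_dup_ge0 ?(ltW s0)//.
rewrite one_sub_sin_dup6//.
have u0 : 0 <= 1 - s ^+ 6 by have := exprn_ge0 6 (ltW s0); lra.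
have v0 : 0 < 1 - 9 * s ^+ 6 by lra.
have c0 : 0 < sin_dup_denom R s `^ (- (1 / 3)) by rewrite powR_gt0.
have cD := cube_powRN13 R _ D0.
move: v0 c0 cD; set v : R := 1 - 9 * _; set c := _ `^ (- (1 / 3)) => v0 c0 cD.
have v3 : 0 <= v ^+ 3 by rewrite exprn_ge0// ltW.
have c6 : 0 <= c ^+ 6 by rewrite exprn_ge0// ltW.
rewrite powRM//; last exact: mulr_ge0.
rewrite powRM// !powRX ?ltW//.
rewrite (_ : 3 * - _ = - 2%:R); last by field.
rewrite (_ : 6 * - _ = - 4%:R); last by field.
rewrite !powR_invn ?ltW// -cD; field.
by rewrite !gt_eqF.
Qed.

(** The difference [h] of the two sides has derivative 0 inside the interval and vanishes at 0. Its
    continuity up to the end gives the case 9 s^6 = 1, which locates a quarter of [gpi]. *)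
Lemma garcsin_sin_dup (R : realType) (s : R) : 0 < @gpi R (3 / 2) 6 ->
  0 <= s -> 9 * s ^+ 6 <= 1 ->
  garcsin (3 / 2) 6 (sin_dup R s) = 2 * garcsin (3 / 2) 6 s.
Proof.
move=> gpi0; rewrite le_eqVlt => /predU1P[<- _|s0 s9].
  by rewrite /sin_dup mulr0 mul0r garcsin0 mulr0.
have q0 : 0 < 6 :> R by [].
have lt9 (t : R) : 0 <= t -> t < s -> 9 * t ^+ 6 < 1.
  move=> t0 ts; apply: lt_le_trans s9.
  by rewrite ltr_pM2l// ltrXn2r// (le_lt_trans t0).
have le9 (t : R) : 0 <= t -> t <= s -> 9 * t ^+ 6 <= 1.
  by move=> t0; rewrite le_eqVlt => /predU1P[->//|ts]; rewrite ltW// lt9.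
have lt1 (t : R) : 0 <= t -> 9 * t ^+ 6 <= 1 -> t < 1.
  by move=> t0 t9; rewrite -(@expr_lt1 _ 6)//; lra.
pose h := (garcsin (3 / 2) 6 \o @sin_dup R) - (2 \*: garcsin (3 / 2) 6).
have dh t : t \in `]0, s[ -> is_derive t 1 h 0.
  rewrite in_itv/= => /andP[t0 ts]; have t9 := lt9 t (ltW t0) ts.
  have dsd := is_derive_sin_dup R t (sin_dup_denom_gt0 R t (ltW t9)).
  have sd01 : 0 < sin_dup R t < 1.
    by rewrite sin_dup_lt1 ?(ltW t0)// !mulr_gt0// powR_gt0// sin_dup_denom_gt0// ltW.
  have t01 : 0 < t < 1 by rewrite t0/= lt1 ?ltW.
  have d1 := is_derive1_comp (is_derive_garcsin R (3 / 2) 6 _ q0 gpi0 sd01) dsd.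
  have d2 := is_derive_garcsin R (3 / 2) 6 t q0 gpi0 t01.
  apply: is_derive_eq; rewrite gsin_integrand_sin_dup//.
  by rewrite /GRing.scale/= subrr.
have ch : {within `[0, s], continuous h}%classic.
  apply: within_continuousB.
    apply: (@within_continuous_comp_within R R R _ `[0, 1]%classic (@sin_dup R)
      (garcsin (3 / 2) 6)).
    - move=> _ /= [t + <-]; rewrite !in_itv/= => /andP[t0 ts].
      rewrite sin_dup_ge0//=.
      have [t9|t9] := eqVneq (9 * t ^+ 6) 1; first by rewrite sin_dup_eq1.
      have {}t9 : 9 * t ^+ 6 < 1 by rewrite lt_neqAle t9 le9.
      by rewrite ltW// sin_dup_lt1.
    - exact: continuous_garcsin.
    - apply: derivable_within_continuous => t; rewrite in_itv/= => /andP[t0 ts].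
      by case: (is_derive_sin_dup R t (sin_dup_denom_gt0 R t (le9 t t0 ts))).
  move=> t; apply: cvgZr.
  apply: (continuous_subspaceW _ (continuous_garcsin R (3 / 2) 6 gpi0)).
  apply: subset_itvl; rewrite bnd_simp ltW// lt1//; exact: ltW.
have [c _] := @MVT _ h (fun=> 0) 0 s s0 dh ch.
rewrite mul0r => /eqP; rewrite subr_eq0 => /eqP.
rewrite /h !fctE /= [sin_dup R 0]/sin_dup mulr0 mul0r garcsin0 scaler0 subrr.
by move=> /eqP; rewrite subr_eq0 => /eqP.
Qed.

Theorem theorem3p3 (R : realType) (x : R)
    (hx : 0 <= x < gpi (3 / 2) 6 / 4) :
  gsin (3 / 2) 6 (2 * x) =
    2 * gsin (3 / 2) 6 x /
      (1 + 18 * gsin (3 / 2) 6 x ^+ 6 - 27 * gsin (3 / 2) 6 x ^+ 12)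
        `^ (1 / 3).
Proof.
have /andP[x0 xpi] := hx.
(* The range of [x] is nonempty; this yields convergence of the integral. *)
have gpi0 : 0 < @gpi R (3 / 2) 6 by lra.
have q0 : 0 < 6 :> R by [].
have [|/andP[y0 y1] yx] := @gsin_inv R (3 / 2) 6 x q0 gpi0; first by lra.
move: (gsin _ _ x) y0 y1 yx => y y0 y1 yx.
rewrite -powRN.
(* The root of 9 s^6 = 1, where [sin_dup] equals 1: hence [garcsin] at [s] is [gpi / 4], and
   monotonicity puts [y] below [s]. *)
pose s : R := (1 / 9) `^ (1 / 6).
have s0 : 0 <= s by exact: powR_ge0.
have s9 : 9 * s ^+ 6 = 1.
  by rewrite -powR_mulrn// -powRrM (_ : _ * 6 = 1) ?powRr1//; field.
have ys : y < s.
  have As : 2 * garcsin (3 / 2) 6 s = garcsin (3 / 2) 6 1.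
    by rewrite -garcsin_sin_dup ?s9// sin_dup_eq1.
  have s1 : s <= 1 by rewrite -(@expr_le1 _ 6)//; lra.
  have y01 : y \in `[0, 1] by rewrite in_itv/= y0 ltW.
  have s01 : s \in `[0, 1] by rewrite in_itv/= s0.
  rewrite -(garcsin_lt R _ _ q0 gpi0 y s y01 s01).
  by rewrite yx; have := @garcsin1 R (3 / 2) 6; lra.
have y9 : 9 * y ^+ 6 < 1 by rewrite -[ltRHS]s9 ltr_pM2l ?ltrXn2r.
(* Now [2 * x] is [garcsin] of [sin_dup R y], which is below 1, so [gsin] recovers it; the
   right-hand side is [sin_dup R y] unfolded. *)
rewrite -yx -(garcsin_sin_dup R y gpi0 y0 (ltW y9)).
rewrite (garcsinK R _ _ q0 gpi0)//.
by rewrite in_itv/= sin_dup_ge0// sin_dup_lt1.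
Qed.
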